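(* Let $F$ be a fixed graph on $f$ vertices with chromatic number $\chi(F)=r+1\geq 2$. Let $(G_m)$ be a sequence of graphs such that $G_m$ has exactly $m$ edges and $N_F(G_m)=o(m^{f/2})$ as $m\to\infty$. Then, as $m\to\infty$, $$\rho(G_m)\leq \begin{cases}\sqrt{\big(1-\frac{1}{r}+o(1)\big)2m}, & \text{if } r\geq 2;\\[1mm] \sqrt{\big(1+o(1)\big)m}, & \text{if } r=1 \text{ and } \beta'(F)\geq 2.\end{cases}$$
   Context: All graphs are finite and simple. For a graph $G$, $\rho(G)$ denotes the spectral radius (largest eigenvalue) of its adjacency matrix $A(G)$, and $N_F(G)$ denotes the number of copies of $F$ in $G$, i.e. the number of (not necessarily induced) subgraphs of $G$ isomorphic to $F$. A covering of a graph is a set of vertices meeting every edge; $\beta'(F)$ denotes the minimum cardinality of an independent covering of $F$ (for bipartite $F$, ignoring isolated vertices). Isolated vertices of the graphs under consideration are disregarded. *)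

(* Defs.v *)
From HB Require Import structures.
From mathcomp Require Import all_boot all_order all_algebra.
From mathcomp Require Import all_classical all_reals all_analysis.

Set Implicit Arguments.
Unset Strict Implicit.
Unset Printing Implicit Defensive.

Import Order.TTheory GRing.Theory Num.Theory.
Import numFieldNormedType.Exports.

Local Open Scope ring_scope.

Record sgraph := SGraph {
  vertex :> finType;
  adj : rel vertex;
  adj_sym : symmetric adj;
  adj_irr : irreflexive adj }.

Definition edges (G : sgraph) : {set {set G}} :=
  [set A : {set G} | [exists x, exists y, adj x y && (A == [set x; y]%SET)]]%SET.

Definition is_subgraph (G : sgraph) (H : {set G} * {set {set G}}) : bool :=
  (H.2 \subset edges G) && [forall A in H.2, A \subset H.1].

(* For H a subgraph of G, i.e. a vertex set and a set of edges: the graph H is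
   isomorphic to F. *)
Definition iso_subgraph (F G : sgraph) (H : {set G} * {set {set G}}) : bool :=
  [exists h : {ffun F -> G},
    [&& injectiveb h,
        [set h x | x in [set: F]%SET]%SET == H.1
      & [forall x, forall y, adj x y == ([set h x; h y]%SET \in H.2)]]].

Definition copies (F G : sgraph) : nat :=
  #|[set H : {set G} * {set {set G}} | is_subgraph H && iso_subgraph F H]%SET|.

Definition colorable (G : sgraph) (k : nat) : bool :=
  [exists c : {ffun G -> 'I_k}, [forall x, forall y, adj x y ==> (c x != c y)]].

Lemma colorable_card (G : sgraph) : exists k, colorable G k.
Proof.
exists #|G|; apply/existsP; exists [ffun x => enum_rank x].
apply/forallP => x; apply/forallP => y; apply/implyP => xy; rewrite !ffunE.
apply/eqP => /enum_rank_inj exy; by rewrite exy (adj_irr y) in xy.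
Qed.

Definition chromatic_number (G : sgraph) : nat := ex_minn (colorable_card G).

Definition independent (G : sgraph) (S : {set G}) : bool :=
  [forall x in S, forall y in S, ~~ adj x y].

Definition covering (G : sgraph) (S : {set G}) : bool :=
  [forall x, forall y, adj x y ==> (x \in S) || (y \in S)].

(* Every bipartite graph has an independent covering, so the default value #|G|
   only matters for non-bipartite G. Isolated vertices of G never belong to a
   minimum independent covering, so they do not affect the value. *)
Definition min_indep_covering (G : sgraph) : nat :=
  \big[minn/#|G|]_(S : {set G} | independent S && covering S) #|S|.

Definition adjmx (R : realType) (G : sgraph) : 'M[R]_#|G| :=
  \matrix_(i, j) (adj (enum_val i) (enum_val j))%:R.

(* The eigenvalues of a real symmetric matrix are real and finite in number, so
   the supremum is the largest eigenvalue; it is 0 for the empty graph. *)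
Definition spectral_radius (R : realType) (G : sgraph) : R :=
  sup [set x : R | eigenvalue (adjmx R G) x]%classic.

(* Main.v *)
Require Import Defs.
From HB Require Import structures.
From mathcomp Require Import all_boot all_order all_algebra.
From mathcomp Require Import all_classical all_reals all_analysis.
From mathcomp Require Import ring lra zify.

(** Let [x] be the entrywise absolute value of a unit eigenvector for an
    eigenvalue [lam] with [lam ^ 2 >= (alpha + eps) m], where [alpha >= 1] and
    [alpha >= 2 (1 - 1/r)].  Edges [uv] whose degree product is far from [m]
    contribute [o(sqrt m)] to [x A x]; by pigeonhole so do the edges meeting some
    narrow range of degrees.  The remaining edges split into a bipartite graph
    between very high and very low degrees, of spectral radius at most [sqrt m],
    and a graph on the set [M] of vertices of degree [Theta(sqrt m)].  Since
    [lam] exceeds [sqrt m], the latter must have large Rayleigh quotient, and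
    Cauchy-Schwarz, as in Nikiforov's use of Motzkin-Straus, shows that the
    probability measure [w] proportional to [x ^ 2] on [M] has edge density more
    than [1 - 1/r].  Erdos-Stone supersaturation for measures then bounds the
    homomorphism density of [F] under [w] from below.  The eigenvalue equation
    gives [w = O(1 / sqrt m)] pointwise, so almost all of these homomorphisms are
    injective and there are of order [m ^ (f/2)] of them. *)

Set Implicit Arguments.
Unset Strict Implicit.
Unset Printing Implicit Defensive.

Import Order.TTheory GRing.Theory Num.Theory.
Import numFieldNormedType.Exports.

Local Open Scope classical_set_scope.
Local Open Scope ring_scope.

(** * Iterated weighted sums, Jensen's inequality and clique densities *)

Section IteratedSum.
Variables (R : realFieldType) (V : finType).
Implicit Types (w : V -> R) (P Q : seq V -> R).

(** An expectation over [n] independent samples from [w] when [w] has total weight 1. *)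
Fixpoint itsum w n P : R :=
  if n is n'.+1 then \sum_v w v * itsum w n' (fun K => P (v :: K))
  else P [::].

Lemma eq_itsum w n P Q : P =1 Q -> itsum w n P = itsum w n Q.
Proof.
elim: n P Q => [|n IH] P Q PQ /=; first exact: PQ.
by apply: eq_bigr => v _; congr (_ * _); apply: IH => K; apply: PQ.
Qed.

Lemma le_itsum w n P Q : (forall v, 0 <= w v) ->
  (forall K, size K = n -> P K <= Q K) -> itsum w n P <= itsum w n Q.
Proof.
move=> w0; elim: n P Q => [|n IH] P Q PQ /=; first exact: PQ.
by apply: ler_sum => v _; apply: ler_wpM2l => //; apply: IH => K sK; apply: PQ; rewrite /= sK.
Qed.

Lemma itsumD w n P Q :
  itsum w n (fun K => P K + Q K) = itsum w n P + itsum w n Q.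
Proof.
elim: n P Q => [|n IH] P Q //=; rewrite -big_split /=.
by apply: eq_bigr => v _; rewrite IH mulrDr.
Qed.

Lemma itsumZ w n P a : itsum w n (fun K => a * P K) = a * itsum w n P.
Proof.
elim: n P => [|n IH] P //=; rewrite mulr_sumr.
by apply: eq_bigr => v _; rewrite IH mulrCA.
Qed.

Lemma itsum_sum (I : finType) w n (P : I -> seq V -> R) :
  itsum w n (fun K => \sum_i P i K) = \sum_i itsum w n (P i).
Proof.
elim: n P => [|n IH] P //=; rewrite exchange_big /=.
by apply: eq_bigr => v _; rewrite IH mulr_sumr.
Qed.

Lemma itsum_cst w n a : itsum w n (fun=> a) = (\sum_v w v) ^+ n * a.
Proof.
elim: n => [|n IH] /=; first by rewrite mul1r.
by under eq_bigr do rewrite IH; rewrite -mulr_suml exprS mulrA.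
Qed.

Lemma itsum_restrict w (p : pred V) n P :
  itsum w n (fun K => (all p K)%:R * P K) =
  itsum (fun v => w v * (p v)%:R) n P.
Proof.
elim: n P => [|n IH] P /=; first by rewrite mul1r.
apply: eq_bigr => v _; rewrite -mulrA; congr (_ * _).
rewrite -IH -itsumZ; apply: eq_itsum => K.
by rewrite -mulnb natrM; ring.
Qed.

(* The tangent line of [t ^+ n.+1] at [p] turns Jensen's inequality into
   linearity and monotonicity of the mean. *)
Lemma exprn_tangent (a p : R) n : 0 <= a -> 0 <= p ->
  n.+1%:R * p ^+ n * a - n%:R * p ^+ n.+1 <= a ^+ n.+1.
Proof.
move=> a0 p0; elim: n => [|n IH]; first by rewrite expr0 !expr1 mul0r !mul1r subr0.
apply: le_trans (_ : a * (n.+1%:R * p ^+ n * a - n%:R * p ^+ n.+1) <= _); last first.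
  by rewrite [in leRHS]exprS ler_wpM2l.
rewrite -subr_ge0.
have -> : a * (n.+1%:R * p ^+ n * a - n%:R * p ^+ n.+1) -
    (n.+2%:R * p ^+ n.+1 * a - n.+1%:R * p ^+ n.+2) =
    n.+1%:R * p ^+ n * (a - p) ^+ 2.
  by rewrite !exprS -!natr1; ring.
by rewrite mulr_ge0 ?sqr_ge0 // mulr_ge0 ?exprn_ge0.
Qed.

Lemma itsum_jensen w n m P : (forall v, 0 <= w v) -> \sum_v w v <= 1 ->
  (forall K, 0 <= P K) ->
  itsum w n P ^+ m.+1 <= itsum w n (fun K => P K ^+ m.+1).
Proof.
move=> w0 w1 P0; set p := itsum w n P.
have p0 : 0 <= p.
  have := le_itsum w0 (fun K (_ : size K = n) => P0 K).
  by rewrite itsum_cst mulr0.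
apply: le_trans (_ : itsum w n (fun K => m.+1%:R * p ^+ m * P K + - (m%:R * p ^+ m.+1)) <= _);
  last by apply: le_itsum => // K _; apply: exprn_tangent.
rewrite itsumD itsumZ itsum_cst -/p mulrN.
(* The constant term of the tangent line is nonpositive, so a total weight below 1 only helps. *)
have W1 : (\sum_v w v) ^+ n <= 1 by rewrite exprn_ile1 // sumr_ge0.
have mp : 0 <= m%:R * p ^+ m.+1 by rewrite mulr_ge0 ?exprn_ge0.
have : (\sum_v w v) ^+ n * (m%:R * p ^+ m.+1) <= m%:R * p ^+ m.+1 by rewrite ler_piMl.
by rewrite -mulrA -exprSr -natr1 mulrDl mul1r; lra.
Qed.

Definition clique_sum (e : rel V) w n := itsum w n (fun K => (pairwise e K)%:R).

(** Conditioning on the first vertex [u] restricts the weight to the neighbours of [u]; the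
    inductions on clique size rest on this. *)
Lemma clique_sumS e w n : clique_sum e w n.+1 =
  \sum_u w u * clique_sum e (fun v => w v * (e u v)%:R) n.
Proof.
apply: eq_bigr => u _; congr (_ * _); rewrite /clique_sum -itsum_restrict.
by apply: eq_itsum => K /=; rewrite -mulnb natrM.
Qed.

Lemma eq_clique_sum e w1 w2 n : w1 =1 w2 -> clique_sum e w1 n = clique_sum e w2 n.
Proof.
rewrite /clique_sum => ww; elim: n (fun K : seq V => _) => [|n IH] P //=.
by apply: eq_bigr => v _; rewrite ww IH.
Qed.

Lemma clique_sum_ge0 e w n : (forall v, 0 <= w v) -> 0 <= clique_sum e w n.
Proof.
move=> w0; have := @le_itsum w n (fun=> 0) (fun K => (pairwise e K)%:R) w0.
by rewrite itsum_cst mulr0; apply.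
Qed.

Lemma clique_sum_le1 e w n : (forall v, 0 <= w v) -> \sum_v w v <= 1 ->
  clique_sum e w n <= 1.
Proof.
move=> w0 w1; apply: (@le_trans _ _ ((\sum_v w v) ^+ n)).
  rewrite -[leRHS]mulr1 -itsum_cst; apply: le_itsum => // K _.
  by case: pairwise.
by rewrite exprn_ile1 // sumr_ge0.
Qed.

(* Pointwise, [c * (g - eta / 2) <= h]. *)
Lemma sum_large_fraction w (g h : V -> R) (eta c : R) :
  (forall v, 0 <= w v) -> \sum_v w v <= 1 -> 0 <= eta -> 0 <= c ->
  (forall v, g v <= 1) -> (forall v, 0 <= h v) ->
  (forall v, eta / 2 <= g v -> c <= h v) ->
  eta <= \sum_v w v * g v -> eta / 2 * c <= \sum_v w v * h v.
Proof.
move=> w0 w1 eta0 c0 g1 h0 gh Hg.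
apply: le_trans (_ : \sum_v w v * (c * (g v - eta / 2)) <= _); last first.
  apply: ler_sum => v _; apply: ler_wpM2l => //.
  case: (lerP (eta / 2) (g v)) => gv.
    by apply: le_trans (gh v gv); rewrite ler_piMr //; have := g1 v; lra.
  by apply: le_trans (h0 v); rewrite mulr_ge0_le0 //; lra.
have -> : \sum_v w v * (c * (g v - eta / 2)) =
    c * (\sum_v w v * g v - \sum_v w v * (eta / 2)).
  rewrite -sumrB mulr_sumr; apply: eq_bigr => v _; ring.
rewrite mulrC; apply: ler_wpM2l => //; rewrite -mulr_suml.
by have : (\sum_v w v) * (eta / 2) <= eta / 2 by [rewrite ler_piMl //; lra]; lra.
Qed.

End IteratedSum.

(** * Supersaturation of cliques above the Turán density *)

Section CliqueSupersaturation.
Variable R : realFieldType.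

Definition edge_sum (V : finType) (e : rel V) (w : V -> R) : R :=
  \sum_u \sum_v w u * w v * (e u v)%:R.

(** Weighted Cauchy-Schwarz, from the nonnegative sum of [p i * (W * a i - b) ^ 2]. *)
Lemma sqr_sum_le (I : finType) (p a : I -> R) : (forall i, 0 <= p i) ->
  (\sum_i p i * a i) ^+ 2 <= (\sum_i p i) * (\sum_i p i * a i ^+ 2).
Proof.
move=> p0; set W := \sum_i p i; set b := \sum_i p i * a i.
have W0 : 0 <= W by apply: sumr_ge0.
have : 0 <= \sum_i p i * (W * a i - b) ^+ 2.
  by apply: sumr_ge0 => i _; rewrite mulr_ge0 ?sqr_ge0.
have -> : \sum_i p i * (W * a i - b) ^+ 2 =
    W * (W * (\sum_i p i * a i ^+ 2) - b ^+ 2).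
  transitivity (\sum_i (W ^+ 2 * (p i * a i ^+ 2) - 2 * W * b * (p i * a i) + b ^+ 2 * p i)).
    by apply: eq_bigr => i _; ring.
  by rewrite big_split sumrB -!mulr_sumr /= -/W -/b; ring.
move: W0; rewrite le_eqVlt => /predU1P[W0 _|W0]; last by rewrite pmulr_rge0 // subr_ge0.
have pz i : p i = 0.
  apply/eqP; rewrite eq_le p0 andbT W0 /W (bigD1 i) //= lerDl.
  by apply: sumr_ge0.
rewrite /b big1 ?expr0n ?mulr_ge0 ?sumr_ge0 //= => i _; rewrite ?pz ?mul0r //.
Qed.

(** The Moon-Moser induction: on average, neighbourhoods exceed the Turán density one step lower, so
    the induction hypothesis applies in many of them. Scaling the threshold by the squared total
    weight lets it apply to restricted weights without renormalising. *)
Lemma clique_supersaturation n (eps : R) : 0 < eps ->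
  exists2 c : R, 0 < c &
  forall (V : finType) (e : rel V) (w : V -> R), symmetric e ->
    (forall v, 0 <= w v) -> \sum_v w v <= 1 ->
    (1 - n.+1%:R^-1) * (\sum_v w v) ^+ 2 + eps <= edge_sum e w ->
    c <= clique_sum e w n.+2.
Proof.
elim: n eps => [|n IH] eps eps0.
  exists eps => // V e w _ w0 w1; rewrite invr1 subrr mul0r add0r => /le_trans; apply.
  rewrite clique_sumS; apply: ler_sum => u _; rewrite clique_sumS mulr_sumr.
  by apply: ler_sum => v _; rewrite /clique_sum /= mulr1 mulrA.
have eta0 : 0 < eps ^+ 2 by rewrite exprn_gt0.
have [c c0 {}IH] := IH (eps ^+ 2 / 2) (divr_gt0 eta0 (ltr0Sn _ 1)).
exists (eps ^+ 2 / 2 * c); first by rewrite mulr_gt0 ?divr_gt0.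
move=> V e w esym w0 w1 He.
set W := \sum_v w v in w1 He.
have W0 : 0 <= W by apply: sumr_ge0.
pose wu u := fun v => w v * (e u v)%:R.
have wu0 u v : 0 <= wu u v by rewrite mulr_ge0.
pose d u := \sum_v wu u v.
have d0 u : 0 <= d u by apply: sumr_ge0.
have d1 u : d u <= W.
  by apply: ler_sum => v _; rewrite ler_piMr // lern1 leq_b1.
(* The surplus of edges in the neighbourhood of [u] over the threshold of the induction
   hypothesis. *)
pose g u := edge_sum e (wu u) - (1 - n.+1%:R^-1) * d u ^+ 2.
have n1 : 0 <= 1 - n.+1%:R^-1 :> R by rewrite subr_ge0 invf_le1 ?ler1n.
rewrite clique_sumS; apply: (@sum_large_fraction _ _ _ g) => //.
- exact: ltW.
- exact: ltW.
- move=> u; apply: (@le_trans _ _ (edge_sum e (wu u))).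
    by rewrite gerBl mulr_ge0 // sqr_ge0.
  apply: (@le_trans _ _ (d u ^+ 2)); last first.
    by rewrite expr_le1 // (le_trans (d1 u)).
  rewrite expr2 /d mulr_suml; apply: ler_sum => v _; rewrite mulr_sumr.
  by apply: ler_sum => z _; rewrite ler_piMr ?mulr_ge0 // lern1 leq_b1.
- by move=> u; apply: clique_sum_ge0; apply: wu0.
- move=> u gu; apply: IH => //; [exact: wu0 | exact: le_trans (d1 u) w1 |].
  by rewrite addrC -lerBrDr.
set E := edge_sum e w in He.
have Ed : E = \sum_u w u * d u.
  apply: eq_bigr => u _; rewrite mulr_sumr; apply: eq_bigr => v _.
  by rewrite /wu mulrA.
set D := \sum_u w u * d u ^+ 2.
have ED : E ^+ 2 <= W * D by rewrite Ed; apply: sqr_sum_le.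
(* For the indicators [a], [b], [c] of the three pairs of a triple,
   [a * b * c >= a * b + a * c - a]; both products sum to [D] by symmetry. *)
have tri : 2 * D - E * W <= \sum_u w u * edge_sum e (wu u).
  have D1 : D = \sum_u \sum_v \sum_z w u * w v * w z * ((e u v)%:R * (e u z)%:R).
    apply: eq_bigr => u _; rewrite expr2 /d mulr_suml mulr_sumr.
    apply: eq_bigr => v _; rewrite !mulr_sumr; apply: eq_bigr => z _.
    by rewrite /wu; ring.
  have D2 : D = \sum_u \sum_v \sum_z w u * w v * w z * ((e u v)%:R * (e v z)%:R).
    rewrite D1 exchange_big /=; apply: eq_bigr => v _; apply: eq_bigr => u _.
    by apply: eq_bigr => z _; rewrite (esym u v); ring.
  have EW : E * W = \sum_u \sum_v \sum_z w u * w v * w z * (e u v)%:R.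
    rewrite mulr_suml; apply: eq_bigr => u _; rewrite mulr_suml.
    apply: eq_bigr => v _; rewrite mulr_sumr; apply: eq_bigr => z _; ring.
  have -> : 2 * D = D + D by ring.
  rewrite {1}D1 D2 EW -big_split -sumrB; apply: ler_sum => u _ /=.
  rewrite mulr_sumr -big_split -sumrB; apply: ler_sum => v _ /=.
  rewrite mulr_sumr -big_split -sumrB; apply: ler_sum => z _ /=.
  have -> : w u * (wu u v * wu u z * (e v z)%:R) =
      w u * w v * w z * ((e u v)%:R * (e u z)%:R * (e v z)%:R) by rewrite /wu; ring.
  rewrite -mulrDr -mulrBr ler_wpM2l ?mulr_ge0 //.
  by case: (e u v) (e u z) (e v z) => [] [] []; rewrite /=; lra.
have -> : \sum_u w u * g u =
    \sum_u w u * edge_sum e (wu u) - (1 - n.+1%:R^-1) * D.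
  by rewrite /D mulr_sumr -sumrB; apply: eq_bigr => u _; rewrite /g; ring.
set T := \sum_u _ in tri *.
(* With [i = 1/(n+1)] and [j = 1/(n+2)], [(1 + i) * (1 - j) = 1], so the hypothesis gives
   [(1 + i) * E >= W ^ 2 + eps]; combine with [E ^ 2 <= W * D] and [E >= eps]. *)
have : eps ^+ 2 <= W * (T - (1 - n.+1%:R^-1) * D).
  apply: (@le_trans _ _ (W * ((1 + n.+1%:R^-1) * D - E * W))); last first.
    apply: ler_wpM2l => //; rewrite -subr_ge0.
    have -> : T - (1 - n.+1%:R^-1) * D - ((1 + n.+1%:R^-1) * D - E * W) =
      T - (2 * D - E * W) by ring.
    by rewrite subr_ge0.
  have nn : (n.+2%:R : R)^-1 * (1 + n.+1%:R^-1) = n.+1%:R^-1.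
    by rewrite -!natr1; field; rewrite !natr1 !pnatr_eq0.
  have i0 : 0 < (n.+1%:R : R)^-1 by rewrite invr_gt0.
  have j0 : 0 < (n.+2%:R : R)^-1 by rewrite invr_gt0.
  have j1 : (n.+2%:R : R)^-1 <= 1 by rewrite invf_le1 ?ler1n.
  move: i0 j0 j1 nn ED He; set i := n.+1%:R^-1; set j := n.+2%:R^-1 => i0 j0 j1 nn ED He.
  have W2 : 0 <= W ^+ 2 by apply: sqr_ge0.
  have Ee : eps <= E by have : 0 <= (1 - j) * W ^+ 2 by [rewrite mulr_ge0 // subr_ge0]; lra.
  have : W ^+ 2 + eps <= (1 + i) * E.
    have : (1 + i) * ((1 - j) * W ^+ 2 + eps) <= (1 + i) * E by rewrite ler_wpM2l //; lra.
    have -> : (1 + i) * ((1 - j) * W ^+ 2 + eps) =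
        (1 + i - j * (1 + i)) * W ^+ 2 + (1 + i) * eps by ring.
    rewrite nn; have : 0 <= i * eps by rewrite mulr_ge0 // ltW.
    lra.
  move=> He2.
  have : E * (W ^+ 2 + eps) <= E * ((1 + i) * E) by rewrite ler_wpM2l //; lra.
  have : (1 + i) * E ^+ 2 <= (1 + i) * (W * D) by rewrite ler_wpM2l //; lra.
  have : eps * eps <= E * eps by rewrite ler_wpM2r // ltW.
  by rewrite !expr2; lra.
move=> H; have T0 : 0 <= T - (1 - n.+1%:R^-1) * D.
  rewrite leNgt; apply/negP => T0.
  by have := mulr_ge0_le0 W0 (ltW T0); move/(le_trans H); rewrite leNgt eta0.
by apply: le_trans H _; rewrite ler_piMl.
Qed.

End CliqueSupersaturation.

(** * Blowing up clique vertices into tuples *)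

Section BlowUp.
Variables (R : realFieldType) (T V : finType).
Implicit Types (w : V -> R) (e : rel V) (phi psi : {ffun T -> V}).

Definition ffun_weight w phi : R := \prod_x w (phi x).

Lemma sum_ffun_weight w : \sum_phi ffun_weight w phi = (\sum_v w v) ^+ #|T|.
Proof. by rewrite -prodr_const bigA_distr_bigA. Qed.

Lemma ffun_weight_ge0 w phi : (forall v, 0 <= w v) -> 0 <= ffun_weight w phi.
Proof. by move=> w0; apply: prodr_ge0. Qed.

Definition joined e phi psi := [forall x, forall y, e (phi x) (psi y)].

Lemma joinedP e phi psi :
  reflect (forall x y, e (phi x) (psi y)) (joined e phi psi).
Proof.
by apply: (iffP forallP) => [H x y|H x]; [have /forallP := H x; apply | apply/forallP].
Qed.

Lemma prod_pred (p : pred T) : \prod_x (p x)%:R = ([forall x, p x])%:R :> R.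
Proof.
case: forallP => [H|/forallP]; first by rewrite big1 // => x _; rewrite H.
by rewrite negb_forall => /existsP[x /negPf px]; rewrite (bigD1 x) //= px mul0r.
Qed.

(** Group the cliques by all but one vertex, [K]. Jensen raises the weight of the common neighbours
    of [K] to the power [#|T|], which is the weight of the maps [phi] with every value adjacent to
    all of [K]. *)
Lemma sum_clique_sum_joined e w n : (0 < #|T|)%N ->
  (forall v, 0 <= w v) -> \sum_v w v <= 1 ->
  clique_sum e w n.+1 ^+ #|T| <=
  \sum_phi ffun_weight w phi *
    clique_sum e (fun v => w v * ([forall x, e (phi x) v])%:R) n.
Proof.
case Tt: #|T| => [//|t] _ w0 w1.
pose X K : R := (pairwise e K)%:R * \sum_u w u * (all (e u) K)%:R.
have X0 K : 0 <= X K.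
  by rewrite mulr_ge0 ?sumr_ge0 // => u _; rewrite mulr_ge0.
have -> : clique_sum e w n.+1 = itsum w n X.
  rewrite clique_sumS.
  under eq_bigr do rewrite /clique_sum -itsum_restrict -itsumZ.
  rewrite -itsum_sum; apply: eq_itsum => K; rewrite /X mulr_sumr.
  by apply: eq_bigr => u _; ring.
apply: (le_trans (itsum_jensen _ _ w0 w1 X0)).
under eq_bigr => phi _ do rewrite /clique_sum -itsum_restrict -itsumZ.
rewrite -itsum_sum; apply: le_itsum => // K _.
have -> : \sum_(phi : {ffun T -> V}) ffun_weight w phi *
    ((all (fun v => [forall x, e (phi x) v]) K)%:R * (pairwise e K)%:R) =
    (pairwise e K)%:R * \sum_(phi : {ffun T -> V})
      ffun_weight (fun u => w u * (all (e u) K)%:R) phi.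
  rewrite mulr_sumr; apply: eq_bigr => phi _.
  rewrite /ffun_weight big_split /= prod_pred.
  have -> : [forall x, all (e (phi x)) K] = all (fun v => [forall x, e (phi x) v]) K.
    apply/forallP/allP => [H v vK|H x].
      by apply/forallP => x; apply: (allP (H x)).
    by apply/allP => v /H /forallP.
  by ring.
rewrite sum_ffun_weight Tt /X exprMn; apply: ler_wpM2r.
  by rewrite exprn_ge0 // sumr_ge0 // => u _; rewrite mulr_ge0.
by case: pairwise; rewrite ?expr1n ?expr0n.
Qed.

End BlowUp.

(** Clique vertices become maps one at a time: once [phi] is fixed, the rest of the clique lives on
    the common neighbours of its values, and the induction hypothesis applies to the restricted
    weight. *)
Lemma blowup_supersaturation (R : realFieldType) (T : finType) n (eps : R) :
  0 < eps -> (0 < #|T|)%N ->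
  exists2 c : R, 0 < c &
  forall (V : finType) (e : rel V) (w : V -> R),
    (forall v, 0 <= w v) -> \sum_v w v <= 1 -> eps <= clique_sum e w n ->
    c <= clique_sum (joined (T := T) e) (ffun_weight w) n.
Proof.
move=> eps0 T0; elim: n eps eps0 => [|n IH] eps eps0; first by exists 1.
have eta0 : 0 < eps ^+ #|T| by rewrite exprn_gt0.
have [c c0 {}IH] := IH (eps ^+ #|T| / 2) (divr_gt0 eta0 (ltr0Sn _ 1)).
exists (eps ^+ #|T| / 2 * c); first by rewrite mulr_gt0 ?divr_gt0.
move=> V e w w0 w1 He.
pose wr (phi : {ffun T -> V}) v := w v * ([forall x, e (phi x) v])%:R.
have wr0 phi v : 0 <= wr phi v by rewrite mulr_ge0.
have wr1 phi : \sum_v wr phi v <= 1.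
  by apply: le_trans w1; apply: ler_sum => v _; rewrite ler_piMr // lern1 leq_b1.
rewrite clique_sumS.
apply: (@sum_large_fraction _ _ _ (fun phi => clique_sum e (wr phi) n)).
- by move=> phi; apply: ffun_weight_ge0.
- by rewrite sum_ffun_weight exprn_ile1 // sumr_ge0.
- exact: ltW.
- exact: ltW.
- by move=> phi; apply: clique_sum_le1.
- by move=> phi; apply: clique_sum_ge0 => psi; rewrite mulr_ge0 ?ffun_weight_ge0.
- move=> phi /(IH _ _ _ (wr0 phi) (wr1 phi)) /le_trans; apply.
  rewrite le_eqVlt; apply/predU1P; left; apply: eq_clique_sum => psi.
  rewrite /ffun_weight big_split /= prod_pred; congr (_ * _%:R).
  congr (nat_of_bool _); apply/forallP/joinedP => [H x y|H y].
    exact: (forallP (H y)).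
  exact/forallP.
apply: le_trans (sum_clique_sum_joined e n T0 w0 w1).
by rewrite lerXn2r ?nnegrE ?clique_sum_ge0 // ltW.
Qed.

(** * From blown-up cliques to homomorphisms of [F] *)

Section MergeClasses.
Variables (R : realFieldType) (T V : finType) (w : V -> R).
Implicit Types (phi psi : {ffun T -> V}) (p : pred T).

Definition splice p phi psi := [ffun x => if p x then phi x else psi x].

(* The pairs [(phi, psi)] and [(splice p phi psi, splice p psi phi)] have the
   same weight, and this exchange is an involution. *)
Lemma sum_splice p (G : {ffun T -> V} -> R) :
  \sum_phi \sum_psi ffun_weight w phi * ffun_weight w psi * G (splice p phi psi) =
  (\sum_v w v) ^+ #|T| * \sum_phi ffun_weight w phi * G phi.
Proof.
pose ex (q : {ffun T -> V} * {ffun T -> V}) := (splice p q.1 q.2, splice p q.2 q.1).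
have exK : involutive ex.
  by case=> phi psi; congr (_, _); apply/ffunP => x; rewrite !ffunE /=; case: (p x).
rewrite pair_big /= (reindex_inj (inv_inj exK)) /=.
transitivity (\sum_(q : {ffun T -> V} * {ffun T -> V})
    ffun_weight w q.1 * ffun_weight w q.2 * G q.1).
  apply: eq_bigr => -[phi psi] _ /=; congr (_ * G _); last first.
    by apply/ffunP => x; rewrite !ffunE; case: (p x).
  rewrite /ffun_weight -!big_split /=; apply: eq_bigr => x _.
  by rewrite !ffunE; case: (p x); rewrite // mulrC.
rewrite -(pair_bigA _ (fun phi psi => ffun_weight w phi * ffun_weight w psi * G phi)) /=.
rewrite -sum_ffun_weight mulr_sumr; apply: eq_bigr => phi _.
by rewrite mulr_suml; apply: eq_bigr => psi _; ring.
Qed.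

Definition merge_classes (c : T -> nat) (L : seq {ffun T -> V}) psi :=
  [ffun x => nth psi L (c x) x].

(** Independent samples of a product measure, one per colour class, combine to a single sample: the
    classes are spliced in one by one. *)
Lemma sum_merge n (c : T -> nat) (G : {ffun T -> V} -> R) : \sum_v w v = 1 ->
  \sum_psi ffun_weight w psi * itsum (ffun_weight w) n (fun L => G (merge_classes c L psi)) =
  \sum_psi ffun_weight w psi * G psi.
Proof.
move=> w1; elim: n c G => [|n IH] c G /=.
  apply: eq_bigr => psi _; congr (_ * G _).
  by apply/ffunP => x; rewrite ffunE nth_nil.
(* Lowering the colours makes classes 0 and 1 collide, but class 0 is overwritten by [phi]. *)
pose c' x := (c x).-1.
transitivity (\sum_phi ffun_weight w phi *
    \sum_psi ffun_weight w psi * G (splice (fun x => c x == 0%N) phi psi)).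
  under eq_bigr do rewrite mulr_sumr.
  rewrite exchange_big /=; apply: eq_bigr => phi _.
  rewrite -(IH c' (fun psi => G (splice _ phi psi))) mulr_sumr.
  apply: eq_bigr => psi _; rewrite mulrCA.
  congr (_ * (_ * _)); apply: eq_itsum => L; congr G.
  by apply/ffunP => x; rewrite !ffunE /c'; case: (c x).
transitivity ((\sum_v w v) ^+ #|T| * \sum_psi ffun_weight w psi * G psi); last first.
  by rewrite w1 expr1n mul1r.
rewrite -(sum_splice (fun x => c x == 0%N)); apply: eq_bigr => phi _.
by rewrite mulr_sumr; apply: eq_bigr => psi _; rewrite mulrA.
Qed.

End MergeClasses.

Definition is_hom (F : sgraph) (V : finType) (e : rel V) (h : {ffun F -> V}) :=
  [forall x, forall y, adj x y ==> e (h x) (h y)].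

(** Given a proper colouring of [F], pairwise joined maps from [F], one per colour, merge into a
    homomorphism; merging preserves the measure. *)
Lemma hom_supersaturation (R : realFieldType) (F : sgraph) n (eps : R) :
  0 < eps -> (0 < #|F|)%N -> colorable F n.+2 ->
  exists2 c : R, 0 < c &
  forall (V : finType) (e : rel V) (w : V -> R), symmetric e ->
    (forall v, 0 <= w v) -> \sum_v w v = 1 ->
    1 - n.+1%:R^-1 + eps <= edge_sum e w ->
    c <= \sum_(h : {ffun F -> V}) ffun_weight w h * (is_hom e h)%:R.
Proof.
move=> eps0 F0 /existsP[col /forallP colP].
have [c1 c10 H1] := clique_supersaturation n eps0.
have [c c0 H2] := blowup_supersaturation n.+2 c10 F0.
exists c => // V e w esym w0 w1 He.
have /(H2 V e w w0) : c1 <= clique_sum e w n.+2.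
  by apply: H1; rewrite ?w1 // expr1n mulr1.
rewrite w1 => /(_ (lexx _)) /le_trans; apply.
rewrite -(sum_merge n.+2 (fun x => col x) (fun h => (is_hom e h)%:R) w1).
have W1 : \sum_(psi : {ffun F -> V}) ffun_weight w psi = 1.
  by rewrite sum_ffun_weight w1 expr1n.
rewrite -[leLHS]mul1r -[X in X * _]W1 mulr_suml.
apply: ler_sum => psi _; apply: ler_wpM2l; first exact: ffun_weight_ge0.
apply: le_itsum => [phi|L sL]; first exact: ffun_weight_ge0.
case: (boolP (pairwise _ L)) => [/(pairwiseP psi) pL|_]; last exact: ler0n.
(* Every colour is below [size L = n.+2], so the default [psi] is never reached. *)
have nL x : (col x : nat) \in gtn (size L) by rewrite inE sL ltn_ord.
suff -> : is_hom e (merge_classes (fun x => col x) L psi) by [].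
apply/forallP => x; apply/forallP => y; apply/implyP => xy; rewrite !ffunE.
have := implyP (forallP (colP x) y) xy; rewrite neq_ltn => /orP[] lt.
  exact: (joinedP _ _ _ (pL _ _ (nL x) (nL y) lt)).
by rewrite esym; apply: (joinedP _ _ _ (pL _ _ (nL y) (nL x) lt)).
Qed.

(** * Classification of edges by the degrees of their ends *)

Section DegreeBands.

(* [Q] stands for [q ^ (2 * j)]: degrees [a] with [m <= a ^ 2 * Q] and
   [a ^ 2 <= m * Q] form the [j]-th middle range. *)
Variables m q Q : nat.
Hypotheses (q0 : (0 < q)%N) (Q0 : (0 < Q)%N).

Definition mid (Q' a : nat) := (m <= a ^ 2 * Q')%N && (a ^ 2 <= m * Q')%N.
(** The gap of [q ^ 2] to [mid Q] puts products with middle degrees off [m] by a factor [q]. Squares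
    keep comparisons with [sqrt m] in the integers. *)
Definition high a := (m * (Q * q ^ 2) < a ^ 2)%N.
Definition low a := (a ^ 2 * (Q * q ^ 2) < m)%N.

Lemma mid_widen a : mid Q a -> mid (Q * q ^ 2) a.
Proof.
have QQ : (Q <= Q * q ^ 2)%N by rewrite leq_pmulr // expn_gt0 q0.
move=> /andP[h1 h2]; apply/andP; split.
  by apply: leq_trans h1 _; rewrite leq_mul2l QQ orbT.
by apply: leq_trans h2 _; rewrite leq_mul2l QQ orbT.
Qed.

Lemma not_mid a : ~~ mid (Q * q ^ 2) a -> high a || low a.
Proof. by rewrite negb_and -!ltnNge orbC. Qed.

Lemma high_low_mid a : (high a + low a + mid Q a <= 1)%N.
Proof.
have QQ : (Q <= Q * q ^ 2)%N by rewrite leq_pmulr // expn_gt0 q0.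
have QQ1 : (1 <= Q * q ^ 2)%N by apply: leq_trans QQ.
have hl : ~~ (high a && low a).
  apply/negP => /andP[h1 h2].
  have : (m * 1 <= m * (Q * q ^ 2))%N by rewrite leq_mul2l QQ1 orbT.
  have : (a ^ 2 * 1 <= a ^ 2 * (Q * q ^ 2))%N by rewrite leq_mul2l QQ1 orbT.
  by move: h1 h2; rewrite /high /low; lia.
have hm : ~~ (high a && mid Q a).
  apply/negP => /andP[h1 /andP[_ h2]].
  have : (m * Q <= m * (Q * q ^ 2))%N by rewrite leq_mul2l QQ orbT.
  by move: h1 h2; rewrite /high; lia.
have lm : ~~ (low a && mid Q a).
  apply/negP => /andP[h1 /andP[h2 _]].
  have : (a ^ 2 * Q <= a ^ 2 * (Q * q ^ 2))%N by rewrite leq_mul2l QQ orbT.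
  by move: h1 h2; rewrite /low; lia.
by move: hl hm lm; case: high; case: low; case: mid.
Qed.

Lemma mid_low_product a b : mid Q a -> low b -> (q * a * b <= m)%N.
Proof.
rewrite leqNgt => /andP[_ h1] h2; apply/negP => h.
have h3 : (m ^ 2 * Q < (q * a * b) ^ 2 * Q)%N by rewrite ltn_pmul2r // ltn_sqr.
have h4 : (a ^ 2 * (b ^ 2 * (Q * q ^ 2)) <= m * Q * m)%N by rewrite leq_mul // ltnW.
move: h3; rewrite ltnNge => /negP; apply.
by apply: leq_trans (leq_trans h4 _); rewrite leq_eqVlt; apply/orP; left; apply/eqP; ring.
Qed.

Lemma mid_high_product a b : mid Q a -> high b -> (q * m <= a * b)%N.
Proof.
rewrite leqNgt => /andP[h1 _] h2; apply/negP => h.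
have h3 : ((a * b) ^ 2 * Q < (q * m) ^ 2 * Q)%N by rewrite ltn_pmul2r // ltn_sqr.
have h4 : (m * (m * (Q * q ^ 2)) <= a ^ 2 * Q * b ^ 2)%N by rewrite leq_mul // ltnW.
move: h3; rewrite ltnNge => /negP; apply.
by apply: leq_trans (leq_trans h4 _); rewrite leq_eqVlt; apply/orP; left; apply/eqP; ring.
Qed.

Lemma high_high_product a b : high a -> high b -> (q * m <= a * b)%N.
Proof.
move=> h1 h2; rewrite -leq_sqr.
apply: leq_trans (_ : (m * (Q * q ^ 2)) * (m * (Q * q ^ 2)) <= _)%N; last first.
  by rewrite expnMn leq_mul // ltnW.
have -> : (m * (Q * q ^ 2) * (m * (Q * q ^ 2)) = (q * m) ^ 2 * (Q * q) ^ 2)%N by ring.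
by rewrite leq_pmulr // expn_gt0 muln_gt0 Q0 q0.
Qed.

Lemma low_low_product a b : low a -> low b -> (q * a * b <= m)%N.
Proof.
move=> h1 h2; rewrite -leq_sqr.
apply: leq_trans (_ : (a ^ 2 * (Q * q ^ 2)) * (b ^ 2 * (Q * q ^ 2)) <= _)%N; last first.
  by rewrite -mulnn leq_mul // ltnW.
have -> : (a ^ 2 * (Q * q ^ 2) * (b ^ 2 * (Q * q ^ 2)) =
    (q * a * b) ^ 2 * (Q * q) ^ 2)%N by ring.
by rewrite leq_pmulr // expn_gt0 muln_gt0 Q0 q0.
Qed.

Definition band a := mid (Q * q ^ 2) a && ~~ mid Q a.

(** Outside the band a degree is middle, high or low; a product strictly within a factor [q] of [m]
    then needs two middle degrees, or a high and a low one. *)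
Lemma edge_class a b :
  [|| (q * a * b <= m)%N, (q * m <= a * b)%N, band a || band b,
      high a && low b || low a && high b | mid Q a && mid Q b].
Proof.
have split a' : [|| mid Q a', band a', high a' | low a'].
  rewrite /band; case: (boolP (mid Q a')) => //= _; rewrite andbT.
  by case: (boolP (mid _ a')) => //= /not_mid.
have [] := (split a, split b).
case/or4P => ha; case/or4P => hb; rewrite ?ha ?hb ?orbT //.
- by rewrite (mid_high_product ha hb) orbT.
- by rewrite (mid_low_product ha hb).
- by rewrite mulnC [(a * b)%N]mulnC (mid_high_product hb ha) orbT.
- by rewrite (high_high_product ha hb) orbT.
- by rewrite -mulnA [(a * b)%N]mulnC mulnA (mid_low_product hb ha).
- by rewrite (low_low_product ha hb).
Qed.

End DegreeBands.

(** * Quadratic forms over sets of pairs *)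

Section PairSums.
Variables (R : realFieldType) (V : finType) (x : V -> R).
Hypothesis x0 : forall v, 0 <= x v.
Implicit Types P : rel V.

Definition pair_count P : R := \sum_u \sum_v (P u v)%:R.
(** The part of the quadratic form at [x] carried by [P]; [pair_form2] is the product measure of [P]
    for the density [x ^ 2], and Cauchy-Schwarz links the two. *)
Definition pair_form P : R := \sum_u \sum_v (P u v)%:R * (x u * x v).
Definition pair_form2 P : R := \sum_u \sum_v (P u v)%:R * (x u ^+ 2 * x v ^+ 2).

Lemma sqr_pair_form P : pair_form P ^+ 2 <= pair_count P * pair_form2 P.
Proof.
rewrite /pair_form /pair_count /pair_form2 !pair_bigA /=.
have := @sqr_sum_le R (V * V)%type (fun q => (P q.1 q.2)%:R) (fun q => x q.1 * x q.2).
move=> /(_ (fun=> ler0n _ _)) /le_trans; apply; rewrite le_eqVlt; apply/orP; left.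
by apply/eqP; congr (_ * _); apply: eq_bigr => q _; rewrite exprMn.
Qed.

Lemma pair_form_le P (n y t : R) : 0 <= t -> pair_count P <= n ->
  pair_form2 P <= y -> n * y <= t ^+ 2 -> pair_form P <= t.
Proof.
move=> t0 Pn Py nyt; rewrite -(@ler_pXn2r _ 2) ?nnegrE //; last first.
  by apply: sumr_ge0 => u _; apply: sumr_ge0 => v _; rewrite !mulr_ge0.
apply: le_trans (sqr_pair_form P) (le_trans _ nyt).
apply: ler_pM => //; apply: sumr_ge0 => u _; apply: sumr_ge0 => v _ //.
by rewrite !mulr_ge0 ?sqr_ge0.
Qed.

Lemma sub_pair_count P P' : (forall u v, P u v -> P' u v) ->
  pair_count P <= pair_count P'.
Proof.
move=> PP; apply: ler_sum => u _; apply: ler_sum => v _; rewrite ler_nat.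
by case: (P u v) (PP u v) => // ->.
Qed.

Lemma pair_form2_prod (p p' : pred V) : pair_form2 (fun u v => p u && p' v) =
  (\sum_u x u ^+ 2 * (p u)%:R) * (\sum_u x u ^+ 2 * (p' u)%:R).
Proof.
rewrite mulr_suml; apply: eq_bigr => u _; rewrite mulr_sumr; apply: eq_bigr => v _.
by rewrite -mulnb natrM; ring.
Qed.

Lemma pair_form2U P P1 P2 : (forall u v, P u v -> P1 u v || P2 u v) ->
  pair_form2 P <= pair_form2 P1 + pair_form2 P2.
Proof.
move=> PP; rewrite -big_split; apply: ler_sum => u _; rewrite -big_split.
apply: ler_sum => v _ /=; rewrite -mulrDl.
apply: ler_wpM2r; first by apply: mulr_ge0; apply: sqr_ge0.
rewrite -natrD ler_nat.
by case: (P u v) (PP u v) => // /(_ isT); case: (P1 u v); case: (P2 u v).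
Qed.

Lemma sub_pair_form2 P P' : (forall u v, P u v -> P' u v) ->
  pair_form2 P <= pair_form2 P'.
Proof.
move=> PP; apply: ler_sum => u _; apply: ler_sum => v _.
apply: ler_wpM2r; first by apply: mulr_ge0; apply: sqr_ge0.
rewrite ler_nat.
by case: (P u v) (PP u v) => // ->.
Qed.

End PairSums.

(** * Concentrating the eigenvector on middle degrees *)

Lemma small_increment (R : realFieldType) (mu : nat -> R) N : (0 < N)%N ->
  0 <= mu 0%N -> mu N <= 1 ->
  exists2 j, (j < N)%N & mu j.+1 - mu j <= N%:R^-1.
Proof.
move=> N0 mu0 mu1; have N0R : (N%:R : R) != 0 by rewrite pnatr_eq0 -lt0n.
case: (boolP [exists j : 'I_N, mu j.+1 - mu j <= N%:R^-1]) => [/existsP[j]|].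
  by exists j.
rewrite negb_exists => /forallP H; exfalso.
have : \sum_(0 <= j < N) N%:R^-1 < \sum_(0 <= j < N) (mu j.+1 - mu j).
  rewrite !big_mkord; apply: ltr_sum => [|j _]; last by rewrite ltNge.
  by apply/hasP; exists (Ordinal N0); rewrite ?mem_index_enum.
rewrite telescope_sumr // sumr_const_nat subn0 -(mulr_natr N%:R^-1) mulVf //.
lra.
Qed.

(* AM-GM: [x_u x_v <= s/k * x_u x_v / sqrt (d_u d_v)] on these pairs, and each
   [x_u ^ 2 / d_u] is summed over the [d_u] neighbours of [u]. *)
Lemma low_product_form (R : rcfType) (V : finType) (e : rel V) (x : V -> R)
    (d : V -> nat) (k m : nat) : symmetric e -> (0 < k)%N -> (0 < m)%N ->
  (forall u, d u = \sum_v e u v)%N ->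
  (forall v, 0 <= x v) -> \sum_v x v ^+ 2 = 1 ->
  pair_form x (fun u v => e u v && (k ^ 2 * d u * d v <= m)%N) <=
    Num.sqrt m%:R / k%:R.
Proof.
move=> esym k0 m0 dE x0 x1; set s := Num.sqrt m%:R / k%:R.
have s0 : 0 <= s by rewrite divr_ge0 ?sqrtr_ge0.
have kn0 : (k%:R : R) != 0 by rewrite pnatr_eq0 -lt0n.
have s2 : s ^+ 2 * k%:R ^+ 2 = m%:R by rewrite /s -exprMn divfK // sqr_sqrtr.
pose a u v : R := (e u v)%:R * (x u ^+ 2 / (d u)%:R).
have asum : \sum_u \sum_v a u v <= 1.
  rewrite -x1; apply: ler_sum => u _; rewrite -mulr_suml -natr_sum -dE.
  case: (d u) => [|n]; first by rewrite mul0r sqr_ge0.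
  by rewrite mulrC divfK ?pnatr_eq0.
apply: le_trans (_ : \sum_u \sum_v s / 2 * (a u v + a v u) <= _); last first.
  have -> : \sum_u \sum_v s / 2 * (a u v + a v u) =
      s / 2 * (\sum_u \sum_v a u v + \sum_u \sum_v a u v).
    rewrite [X in _ * (_ + X)]exchange_big -big_split mulr_sumr.
    by apply: eq_bigr => u _; rewrite -big_split mulr_sumr.
  apply: le_trans (_ : s / 2 * (1 + 1) <= _); last by lra.
  by rewrite ler_wpM2l ?lerD // divr_ge0.
apply: ler_sum => u _; apply: ler_sum => v _; rewrite /a (esym v u).
case: (boolP (e u v)) => /= [uv|_]; last by rewrite !mul0r addr0 mulr0.
have du : (0 < d u)%N by rewrite dE (bigD1 v) //= uv.
have dv : (0 < d v)%N by rewrite dE (bigD1 u) //= esym uv.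
rewrite !mul1r; case: (leqP (k ^ 2 * d u * d v) m) => h /=; last first.
  by rewrite mul0r mulr_ge0 ?addr_ge0 ?divr_ge0 ?sqr_ge0.
rewrite mul1r; have {}h : (d u)%:R * (d v)%:R <= s ^+ 2 :> R.
  rewrite -(@ler_pM2r _ (k%:R ^+ 2)) ?exprn_gt0 ?ltr0n // s2 -natrX -!natrM ler_nat.
  by rewrite mulnC mulnA.
have {}du : 0 < (d u)%:R :> R by rewrite ltr0n.
have {}dv : 0 < (d v)%:R :> R by rewrite ltr0n.
move: (d u)%:R (d v)%:R (x u) (x v) (x0 u) (x0 v) du dv h => b c p q p0 q0 b0 c0 h.
have pq0 : 0 <= p * q by rewrite mulr_ge0.
have bc0 : 0 < b * c by rewrite mulr_gt0.
rewrite -(@ler_pM2r _ (2 * (b * c))) ?mulr_gt0 //.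
have -> : s / 2 * (p ^+ 2 / b + q ^+ 2 / c) * (2 * (b * c)) =
    s * (p ^+ 2 * c + q ^+ 2 * b) by field; rewrite !gt_eqF.
have z0 : 0 <= s * (p ^+ 2 * c + q ^+ 2 * b).
  by rewrite mulr_ge0 // addr_ge0 // mulr_ge0 ?sqr_ge0 // ltW.
rewrite -(@ler_pXn2r _ 2) ?nnegrE //; last by rewrite mulr_ge0 // ltW // mulr_gt0.
rewrite [leRHS]exprMn; apply: (@le_trans _ _ (b * c * (p ^+ 2 * c + q ^+ 2 * b) ^+ 2)).
  rewrite -subr_ge0.
  have -> : b * c * (p ^+ 2 * c + q ^+ 2 * b) ^+ 2 - (p * q * (2 * (b * c))) ^+ 2 =
    b * c * (p ^+ 2 * c - q ^+ 2 * b) ^+ 2 by ring.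
  by rewrite mulr_ge0 ?sqr_ge0 // ltW.
by rewrite ler_wpM2r ?sqr_ge0.
Qed.

(** The weight is [x ^ 2] on a middle range of degrees, normalised. It is dense because the other
    edges contribute at most about [sqrt m] times the remaining mass. *)
Lemma weight_concentration (R : realType) (alpha eps : R) :
  1 <= alpha -> 0 < eps ->
  exists2 kappa : R, 0 < kappa &
  forall (V : finType) (e : rel V) (x : V -> R) (m : nat) (lam : R),
    symmetric e -> (0 < m)%N -> (\sum_u \sum_v e u v = 2 * m)%N ->
    (forall v, 0 <= x v) -> \sum_v x v ^+ 2 = 1 ->
    (forall u, lam * x u <= \sum_v (e u v)%:R * x v) ->
    Num.sqrt ((alpha + eps) * m%:R) <= lam ->
    exists w : V -> R, [/\ forall v, 0 <= w v, \sum_v w v = 1,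
      forall v, w v <= kappa / Num.sqrt m%:R
      & alpha / 2 + eps / 4 <= edge_sum e w].
Proof.
move=> alpha1 eps0.
(* The gap between [th] and [th1] absorbs the error terms; [th1 ^ 2 / 2] is the density reached. *)
pose th := Num.sqrt (alpha + eps); pose th1 := Num.sqrt (alpha + eps / 2).
have th1_gt1 : 1 < th1 by rewrite -sqrtr1 ltr_sqrt; lra.
have th1_lt : th1 < th by rewrite ltr_sqrt; lra.
(* Low products, high products and the band cost [1/k], [2/k] and [2/k] in units of [sqrt m], hence
   5. *)
have [k k0 kth] : exists2 k : nat, (0 < k)%N & 5 / k%:R <= th - th1.
  exists (Num.trunc (5 / (th - th1))).+1 => //.
  rewrite ler_pdivrMr // mulrC -ler_pdivrMr ?subr_gt0 //.
  exact/ltW/truncnS_gt.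
pose q := (k ^ 2)%N; pose N := (k ^ 2)%N.
have q0 : (0 < q)%N by rewrite expn_gt0 k0.
(* Middle degrees are at most [q ^ N * sqrt m], and the normalising mass will be at least
   [th1 - 1]. *)
exists ((q ^ N)%:R / (th1 - 1)).
  by rewrite divr_gt0 ?subr_gt0 // ltr0n expn_gt0 q0.
move=> V e x m lam esym m0 em x0 x1 xlam lamm.
set s := Num.sqrt m%:R.
have s0 : 0 < s by rewrite sqrtr_gt0 ltr0n.
have s2 : s ^+ 2 = m%:R by rewrite sqr_sqrtr.
have kR0 : 0 < k%:R :> R by rewrite ltr0n.
have ths : th * s <= lam by rewrite /th /s -sqrtrM //; lra.
pose d u := (\sum_v e u v)%N.
have eN : pair_count R e = 2 * m%:R.
  by rewrite -natrM -em natr_sum; apply: eq_bigr => u _; rewrite natr_sum.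
pose M j u := mid m (q ^ (2 * j)) (d u).
pose mu j := \sum_u x u ^+ 2 * (M j u)%:R.
have mu_ge0 j : 0 <= mu j by apply: sumr_ge0 => u _; rewrite mulr_ge0 ?sqr_ge0.
have mu_le1 j : mu j <= 1.
  by rewrite -x1; apply: ler_sum => u _; rewrite ler_piMr ?sqr_ge0 // lern1 leq_b1.
(* A range [j] whose increment to the next range, the mass of the band, is at most [1/N]. *)
have [j jN muj] := small_increment q0 (mu_ge0 0%N) (mu_le1 N).
pose Q := (q ^ (2 * j))%N.
have Q0 : (0 < Q)%N by rewrite expn_gt0 q0.
have QS : (q ^ (2 * j.+1) = Q * q ^ 2)%N by rewrite mulnS expnD mulnC.
pose B u := band m q Q (d u); pose H u := high m q Q (d u); pose L u := low m q Q (d u).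
pose c := mu j.
pose mass (p : pred V) := \sum_u x u ^+ 2 * (p u)%:R.
have massT : mass predT = 1 by rewrite -x1; apply: eq_bigr => u _; rewrite mulr1.
have massB : mass B <= N%:R^-1.
  apply: le_trans muj; rewrite -sumrB; apply: ler_sum => u _; rewrite -mulrBr.
  rewrite ler_wpM2l ?sqr_ge0 // /B /band /M QS -/Q.
  by case: (boolP (mid m Q _)) => [/(mid_widen q0)->|_] /=;
    rewrite ?andbT ?andbF ?subrr ?subr0.
have massHLM : mass H + mass L + c <= 1.
  rewrite -x1 -!big_split; apply: ler_sum => u _ /=; rewrite -!mulrDr.
  by rewrite ler_piMr ?sqr_ge0 // -!natrD lern1 high_low_mid.
pose Plow u v := e u v && (k ^ 2 * d u * d v <= m)%N.
pose Phigh u v := e u v && (q * m <= d u * d v)%N.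
pose PB u v := e u v && (B u || B v).
pose PHL u v := e u v && (H u && L v || L u && H v).
pose PM u v := e u v && (M j u && M j v).
have Hlow : pair_form x Plow <= s / k%:R by apply: low_product_form.
(* Markov: [d u * d v] sums to [4 * m ^ 2], so at most [4 * m / q] ordered pairs reach [q * m]. *)
have Hhigh : pair_form x Phigh <= 2 * s / k%:R.
  apply: (@pair_form_le _ _ _ x0 _ (4 * m%:R / k%:R ^+ 2) 1).
  - by rewrite divr_ge0 // mulr_ge0 // ltW.
  - have -> : 4 * m%:R / k%:R ^+ 2 =
        \sum_u \sum_v (d u)%:R * (d v)%:R / (q * m)%:R :> R.
      have dm : \sum_u (d u)%:R = 2 * m%:R :> R by rewrite -natr_sum em natrM.
      under eq_bigr do rewrite -mulr_suml -mulr_sumr.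
      rewrite -!mulr_suml dm natrM natrX; field.
      by rewrite !pnatr_eq0 -!lt0n m0 k0.
    apply: ler_sum => u _; apply: ler_sum => v _; rewrite /Phigh.
    case: (boolP (_ && _)) => [/andP[_ h]|_]; last by rewrite divr_ge0 ?mulr_ge0.
    have qm0 : 0 < (q * m)%:R :> R by rewrite ltr0n muln_gt0 q0.
    by rewrite ler_pdivlMr // -2!natrM ler_nat mul1n.
  - apply: (@le_trans _ _ (pair_form2 x (fun u v => predT u && predT v))).
      exact: sub_pair_form2.
    by rewrite pair_form2_prod -!/(mass predT) massT mulr1.
  - by rewrite mulr1 expr_div_n exprMn s2; lra.
have HB : pair_form x PB <= 2 * s / k%:R.
  apply: (@pair_form_le _ _ _ x0 _ (2 * m%:R) (2 * N%:R^-1)).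
  - by rewrite divr_ge0 // mulr_ge0 // ltW.
  - by rewrite -eN; apply: sub_pair_count => u v /andP[].
  - apply: (@le_trans _ _ (pair_form2 x (fun u v => B u && predT v) +
      pair_form2 x (fun u v => predT u && B v))).
      by apply: pair_form2U => u v /andP[_]; rewrite andbT.
    rewrite !pair_form2_prod -!/(mass _) massT mulr1 mul1r; lra.
  - by rewrite /N natrX expr_div_n exprMn s2; lra.
(* The [sqrt m] bound for bipartite graphs, from [4 * mass H * mass L <= (mass H + mass L) ^ 2]. *)
have HHL : pair_form x PHL <= s * (1 - c).
  have mH0 : 0 <= mass H by apply: sumr_ge0 => u _; rewrite mulr_ge0 ?sqr_ge0.
  have mL0 : 0 <= mass L by apply: sumr_ge0 => u _; rewrite mulr_ge0 ?sqr_ge0.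
  apply: le_trans (_ : s * (mass H + mass L) <= _); last first.
    by apply: ler_wpM2l; [exact: ltW | lra].
  apply: (@pair_form_le _ _ _ x0 _ (2 * m%:R) (2 * (mass H * mass L))).
  - by rewrite mulr_ge0 ?addr_ge0 // ltW.
  - by rewrite -eN; apply: sub_pair_count => u v /andP[].
  - apply: (@le_trans _ _ (pair_form2 x (fun u v => H u && L v) +
      pair_form2 x (fun u v => L u && H v))).
      by apply: pair_form2U => u v /andP[].
    rewrite !pair_form2_prod -!/(mass _); lra.
  - rewrite exprMn s2 -subr_ge0.
    have -> : m%:R * (mass H + mass L) ^+ 2 - 2 * m%:R * (2 * (mass H * mass L)) =
      m%:R * (mass H - mass L) ^+ 2 by ring.
    by rewrite mulr_ge0 ?sqr_ge0.
have Hsum : lam <= pair_form x Plow + pair_form x Phigh + pair_form x PB +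
    pair_form x PHL + pair_form x PM.
  apply: le_trans (_ : pair_form x e <= _).
    rewrite -[leLHS]mulr1 -x1 mulr_sumr; apply: ler_sum => u _.
    rewrite expr2 mulrA; apply: le_trans (ler_wpM2r (x0 u) (xlam u)) _.
    rewrite mulr_suml; apply: ler_sum => v _; lra.
  rewrite -!big_split; apply: ler_sum => u _; rewrite -!big_split.
  apply: ler_sum => v _ /=; rewrite -!mulrDl ler_wpM2r ?mulr_ge0 // -!natrD ler_nat.
  rewrite /Plow /Phigh /PB /PHL /PM; case: (e u v) => //=.
  have bor (b1 b2 b3 b4 b5 : bool) :
      [|| b1, b2, b3, b4 | b5] -> (1 <= b1 + b2 + b3 + b4 + b5)%N.
    by case: b1; case: b2; case: b3; case: b4; case: b5.
  exact/bor/edge_class.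
have PMsq := sqr_pair_form x PM.
have PMcount : pair_count R PM <= 2 * m%:R.
  by rewrite -eN; apply: sub_pair_count => u v /andP[].
have PM2 : pair_form2 x PM <= c ^+ 2.
  apply: (@le_trans _ _ (pair_form2 x (fun u v => M j u && M j v))).
    by apply: sub_pair_form2 => u v /andP[].
  by rewrite pair_form2_prod.
have PM20 : 0 <= pair_form2 x PM.
  by apply: sumr_ge0 => u _; apply: sumr_ge0 => v _; rewrite !mulr_ge0 ?sqr_ge0.
have {}PMsq : pair_form x PM ^+ 2 <= 2 * m%:R * pair_form2 x PM.
  by apply: le_trans PMsq _; rewrite ler_wpM2r.
have c1 : c <= 1 by apply: mu_le1.
(* From [lam >= th * s] subtract the errors [5 * s / k] and the high-low part [s * (1 - c)]. *)
have PMlow : s * (th1 - 1 + c) <= pair_form x PM.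
  have : 5 / k%:R * s <= (th - th1) * s by rewrite ler_wpM2r // ltW.
  by lra.
(* Comparison with the crude upper bound [2 * s * c] keeps [c] away from 0. *)
have c0 : th1 - 1 <= c.
  have : pair_form x PM <= 2 * s * c.
    apply: (@pair_form_le _ _ _ x0 _ (2 * m%:R) (c ^+ 2)) => //.
      by rewrite mulr_ge0 ?mu_ge0 // mulr_ge0 // ltW.
    rewrite !exprMn s2 -subr_ge0.
    have -> : 2 ^+ 2 * m%:R * c ^+ 2 - 2 * m%:R * c ^+ 2 = 2 * m%:R * c ^+ 2 :> R by ring.
    by rewrite mulr_ge0 ?sqr_ge0 // mulr_ge0.
  move/(le_trans PMlow); rewrite mulrAC mulrC ler_pM2r //; lra.
have cp : 0 < c by apply: lt_le_trans c0; rewrite subr_gt0.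
(* Since [(th1 - 1) * (1 - c) >= 0], the lower bound is at least [s * th1 * c]; squaring and
   Cauchy-Schwarz then cancel [m]. *)
have dens : th1 ^+ 2 * c ^+ 2 <= 2 * pair_form2 x PM.
  have h1 : s * (th1 * c) <= pair_form x PM.
    apply: le_trans PMlow; apply: ler_wpM2l; first exact: ltW.
    rewrite -subr_ge0.
    have -> : th1 - 1 + c - th1 * c = (th1 - 1) * (1 - c) by ring.
    by rewrite mulr_ge0 // subr_ge0 // ltW.
  have h0 : 0 <= s * (th1 * c) by rewrite !mulr_ge0 ?ltW //; lra.
  have : (s * (th1 * c)) ^+ 2 <= pair_form x PM ^+ 2.
    by rewrite ler_pXn2r ?nnegrE // (le_trans h0).
  move/le_trans/(_ PMsq); rewrite exprMn s2 exprMn => h.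
  by rewrite -(@ler_pM2l _ m%:R) ?ltr0n //; lra.
exists (fun u => x u ^+ 2 * (M j u)%:R / c); split.
- by move=> u; apply: divr_ge0; [apply: mulr_ge0 => //; exact: sqr_ge0 | exact: ltW].
- by rewrite -mulr_suml divff ?gt_eqF.
- move=> u; case: (boolP (M j u)) => [Mu|_]; last first.
    by rewrite mulr0 mul0r !divr_ge0 ?sqrtr_ge0 // subr_ge0 ltW.
  rewrite mulr1.
  (* Cauchy-Schwarz over the [d u] neighbours of [u], with [x] of unit norm. *)
  have xd : lam ^+ 2 * x u ^+ 2 <= (d u)%:R.
    rewrite -exprMn; apply: le_trans (_ : (\sum_v (e u v)%:R * x v) ^+ 2 <= _).
      have lx0 : 0 <= lam * x u.
        by rewrite mulr_ge0 // (le_trans _ lamm) // sqrtr_ge0.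
      by rewrite ler_pXn2r ?nnegrE // (le_trans lx0).
    apply: le_trans (sqr_sum_le _ _) _ => //; rewrite -natr_sum -/(d u).
    apply: ler_piMr => //; apply: (@le_trans _ _ (\sum_v x v ^+ 2)); last by rewrite x1.
    apply: ler_sum => v _.
    by rewrite ler_piMl ?sqr_ge0 // lern1 leq_b1.
  have lam2 : m%:R <= lam ^+ 2.
    have sl : s <= lam by apply: le_trans ths; rewrite ler_peMl //; [exact: ltW | lra].
    by rewrite -s2 !expr2; apply: ler_pM => //; exact: ltW.
  have dq : (d u)%:R <= s * (q ^ N)%:R.
    have sq0 : 0 <= s * (q ^ N)%:R by rewrite mulr_ge0 // ltW.
    rewrite -(@ler_pXn2r _ 2) ?nnegrE // exprMn s2 -!natrX -natrM ler_nat.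
    have /andP[_ /leq_trans] := Mu; apply; rewrite leq_mul2l -expnM mulnC; apply/orP; right.
    by rewrite leq_pexp2l // leq_mul2r ltnW.
  have xs : x u ^+ 2 <= (q ^ N)%:R / s.
    rewrite ler_pdivlMr // -(@ler_pM2l _ s) // mulrCA -expr2 s2 mulrC.
    apply: le_trans dq; apply: le_trans xd; by rewrite ler_wpM2r ?sqr_ge0.
  have c0p : 0 < th1 - 1 by rewrite subr_gt0.
  rewrite [leRHS]mulrAC; apply: (ler_pM (sqr_ge0 _) _ xs _).
    by rewrite invr_ge0 ltW.
  by rewrite lef_pV2 ?posrE.
- have -> : edge_sum e (fun u => x u ^+ 2 * (M j u)%:R / c) = pair_form2 x PM / c ^+ 2.
    rewrite mulr_suml; apply: eq_bigr => u _; rewrite mulr_suml; apply: eq_bigr => v _.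
    by rewrite /PM -!mulnb !natrM; field; rewrite gt_eqF.
  rewrite ler_pdivlMr ?exprn_gt0 //.
  move: dens; rewrite sqr_sqrtr; lra.
Qed.

(** * From weighted homomorphisms to copies of [F] *)

Section InjectiveHoms.
Variables (R : realFieldType) (F : sgraph) (V : finType) (w : V -> R) (kappa : R).
Hypotheses (w0 : forall v, 0 <= w v) (w1 : \sum_v w v = 1)
  (wk : forall v, w v <= kappa).

(** Distinct coordinates are independent under the product measure, so they collide with probability
    [sum w v ^ 2 <= kappa]. *)
Lemma sum_ffun_collision (x y : F) : x != y ->
  \sum_(h : {ffun F -> V}) ffun_weight w h * (h x == h y)%:R <= kappa.
Proof.
move=> xy.
(* The product of [a v z (h z)] over [z] is the weight of [h] if [h x = h y = v] and 0 otherwise, so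
   the sum over [h] factorises. *)
pose a v z u : R := w u * ((z == x) || (z == y) ==> (u == v))%:R.
have -> : \sum_(h : {ffun F -> V}) ffun_weight w h * (h x == h y)%:R =
    \sum_v \sum_(h : {ffun F -> V}) \prod_z a v z (h z).
  rewrite exchange_big; apply: eq_bigr => h _ /=.
  under eq_bigr do rewrite big_split /= prod_pred.
  rewrite -mulr_sumr; congr (_ * _); rewrite (bigD1 (h x)) //= big1 ?addr0.
    congr (nat_of_bool _)%:R; apply/eqP/forallP => [exy z|/(_ y)].
      by apply/implyP => /orP[]/eqP-> //; rewrite exy.
    by rewrite eqxx orbT /= eq_sym => /eqP.
  move=> v vx; case: forallP => // /(_ x); rewrite eqxx /= eq_sym => /eqP vx'.
  by rewrite vx' eqxx in vx.
apply: le_trans (_ : \sum_v w v * kappa <= _); last by rewrite -mulr_suml w1 mul1r.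
apply: ler_sum => v _; rewrite -bigA_distr_bigA (bigD1 x) //= (bigD1 y) 1?eq_sym //=.
have av z : (z == x) || (z == y) -> \sum_u a v z u = w v.
  move=> zxy; rewrite (bigD1 v) //= /a zxy eqxx mulr1 big1 ?addr0 // => u /negPf->.
  by rewrite mulr0.
rewrite !av ?eqxx ?orbT // big1 ?mulr1 ?ler_wpM2l // => z /andP[/negPf zx /negPf zy].
by rewrite -[RHS]w1; apply: eq_bigr => u _; rewrite /a zx zy mulr1.
Qed.

(** Union bound over the ordered pairs that may collide. *)
Lemma sum_ffun_noninjective :
  \sum_(h : {ffun F -> V}) ffun_weight w h * (~~ injectiveb h)%:R <=
    (#|F| ^ 2)%:R * kappa.
Proof.
have k0 (v : V) : 0 <= kappa := le_trans (w0 v) (wk v).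
have kF (x : F) : 0 <= kappa.
  case: (pickP (fun _ : V => true)) => [v _|V0]; first exact: k0 v.
  by move: w1; rewrite big_pred0 // => /eqP; rewrite eq_sym oner_eq0.
apply: le_trans (_ : \sum_(h : {ffun F -> V}) \sum_(x : F) \sum_(y : F | x != y)
    ffun_weight w h * (h x == h y)%:R <= _).
  apply: ler_sum => h _.
  have nn x y : 0 <= ffun_weight w h * (h x == h y)%:R.
    by rewrite mulr_ge0 // ffun_weight_ge0.
  case: injectiveP => /= [_|]; first by rewrite mulr0 sumr_ge0 // => x _; rewrite sumr_ge0.
  move=> /injectiveP /injectivePn[x [y xy hxy]].
  rewrite (bigD1 x) //= (bigD1 y) //= hxy eqxx -addrA lerDl addr_ge0 //.
    by apply: sumr_ge0.
  by apply: sumr_ge0 => z _; apply: sumr_ge0.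
rewrite exchange_big; under eq_bigr do rewrite exchange_big /=.
apply: le_trans (_ : \sum_(x : F) \sum_(y : F) kappa <= _); last first.
  by rewrite !sumr_const -mulrnA mulnn mulr_natl.
apply: ler_sum => x _; rewrite [leRHS](bigID (fun y => x != y)) /= -[leLHS]addr0.
apply: lerD; last by apply: sumr_ge0 => y _; exact: kF x.
by apply: ler_sum => y; apply: sum_ffun_collision.
Qed.

(** Discard the non-injective maps; each remaining one weighs at most [kappa ^ #|F|]. *)
Lemma injective_hom_count (e : rel V) (c : R) :
  c <= \sum_(h : {ffun F -> V}) ffun_weight w h * (is_hom e h)%:R ->
  c - (#|F| ^ 2)%:R * kappa <=
    #|[pred h : {ffun F -> V} | is_hom e h && injectiveb h]|%:R * kappa ^+ #|F|.
Proof.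
move=> Hc; rewrite lerBlDr; apply: le_trans Hc _.
apply: le_trans (lerD (lexx _) sum_ffun_noninjective).
have -> : #|[pred h : {ffun F -> V} | is_hom e h && injectiveb h]|%:R * kappa ^+ #|F| =
    \sum_(h : {ffun F -> V}) (is_hom e h && injectiveb h)%:R * kappa ^+ #|F|.
  rewrite -sum1_card natr_sum big_mkcond mulr_suml; apply: eq_bigr => h _.
  by rewrite inE; case: (_ && _).
rewrite -big_split; apply: ler_sum => h _ /=.
have hw : ffun_weight w h <= kappa ^+ #|F|.
  by rewrite -prodr_const; apply: ler_prod => x _; rewrite w0 wk.
have h0 : 0 <= ffun_weight w h by apply: ffun_weight_ge0.
by case: (is_hom e h); case: (injectiveb h);
  rewrite /= ?mulr1 ?mul1r ?mulr0 ?mul0r ?addr0 ?add0r.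
Qed.

End InjectiveHoms.

(** Send each map to its image subgraph: all maps with a given image take values in the same [#|F|]
    vertices. *)
Lemma injective_homs_copies (F G : sgraph) :
  (#|[pred h : {ffun F -> G} | is_hom (@adj G) h && injectiveb h]| <=
    copies F G * #|F| ^ #|F|)%N.
Proof.
pose im (h : {ffun F -> G}) : {set G} * {set {set G}} :=
  ([set h x | x in [set: F]%SET]%SET,
   [set [set h q.1; h q.2]%SET | q in [pred q : F * F | adj q.1 q.2]]%SET).
rewrite -sum1_card (partition_big im (fun H => H \in
  [set H : {set G} * {set {set G}} | is_subgraph H && iso_subgraph F H]%SET)) /=.
  rewrite -[X in (_ <= X)%N]sum_nat_const; apply: leq_sum => H.
  rewrite inE => /andP[_ /existsP[h0 /and3P[/injectiveP h0i /eqP h0H _]]].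
  have HF : #|H.1| = #|F| by rewrite -h0H card_imset // cardsT.
  rewrite sum1_card -{1}HF -card_ffun_on; apply/subset_leq_card/fintype.subsetP => h.
  rewrite inE => /andP[_ /eqP <-]; apply/ffun_onP => x.
  by apply: imset_f; rewrite inE.
move=> h /andP[/forallP hh /injectiveP hi].
have hadj x y : adj x y -> adj (h x) (h y) by move: (hh x) => /forallP/(_ y)/implyP.
rewrite inE; apply/andP; split.
  apply/andP; split.
    apply/fintype.subsetP => A /imsetP[[x y]]; rewrite inE /= => xy ->.
    rewrite inE; apply/existsP; exists (h x); apply/existsP; exists (h y).
    by rewrite hadj //= eqxx.
  apply/forallP => A; apply/implyP => /imsetP[[x y]]; rewrite inE /= => xy ->.
  by apply/fintype.subsetP => z; rewrite !inE => /orP[]/eqP->; apply: imset_f; rewrite inE.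
apply/existsP; exists h; apply/and3P; split; [exact/injectiveP|by []|].
apply/forallP => x; apply/forallP => y; apply/eqP; apply/idP/imsetP => [xy|].
  by exists (x, y).
case=> -[x' y']; rewrite inE /= => xy' /setP E.
have hx : (x == x') || (x == y').
  by have := E (h x); rewrite !inE eqxx !(inj_eq hi) => <-.
have hy : (y == x') || (y == y').
  by have := E (h y); rewrite !inE eqxx orbT !(inj_eq hi) => <-.
have hx' : (x' == x) || (x' == y).
  by have := E (h x'); rewrite !inE eqxx !(inj_eq hi) => ->.
have hy' : (y' == x) || (y' == y).
  by have := E (h y'); rewrite !inE eqxx orbT !(inj_eq hi) => ->.
case/orP: hx => /eqP ex; case/orP: hy => /eqP ey; subst x y => //.
- by case/orP: hy' => /eqP ey'; rewrite ey' in xy'.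
- by rewrite adj_sym.
- by case/orP: hx' => /eqP ex'; rewrite ex' in xy'.
Qed.

(** * Edge counts, eigenvectors and the asymptotic spectral bound *)

Lemma sum_adj_edges (G : sgraph) :
  (\sum_(u : G) \sum_(v : G) adj u v = 2 * #|edges G|)%N.
Proof.
rewrite pair_bigA /= -big_mkcond /=.
rewrite (partition_big (fun q : G * G => [set q.1; q.2]%SET) (mem (edges G))) /=.
  rewrite mulnC -sum_nat_const; apply: eq_bigr => A.
  rewrite inE => /existsP[x /existsP[y /andP[xy /eqP->]]].
  have nxy : x != y by apply: contraTneq xy => ->; rewrite adj_irr.
  rewrite sum1_card; transitivity #|[set (x, y); (y, x)]%SET|; last first.
    by rewrite cards2 xpair_eqE negb_and nxy.
  apply: eq_card => -[u v]; rewrite !inE /= !xpair_eqE.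
  apply/andP/orP => [[uv /eqP/setP E]|[]/andP[/eqP-> /eqP->]]; last first.
  - by rewrite adj_sym xy finset.setUC eqxx.
  - by rewrite xy eqxx.
  have nuv : u != v by apply: contraTneq uv => ->; rewrite adj_irr.
  have := E u; have := E v; rewrite !inE !eqxx orbT /= => /esym hv /esym hu.
  case/orP: hu => /eqP eu; case/orP: hv => /eqP ev; subst.
  - by rewrite eqxx in nuv.
  - by left; rewrite !eqxx.
  - by right; rewrite !eqxx.
  - by rewrite eqxx in nuv.
move=> [u v] /= uv; rewrite inE; apply/existsP; exists u; apply/existsP; exists v.
by rewrite uv eqxx.
Qed.

(** Absolute values and the triangle inequality turn the eigenvector equation into an inequality;
    then scale to unit norm. *)
Lemma eigenvalue_subeigenvector (R : realType) (G : sgraph) (lam : R) :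
  0 <= lam -> eigenvalue (adjmx R G) lam ->
  exists x : G -> R, [/\ forall v, 0 <= x v, \sum_v x v ^+ 2 = 1
    & forall u, lam * x u <= \sum_v (adj u v)%:R * x v].
Proof.
move=> lam0 /eigenvalueP[z zE z0].
pose y u := `|z ord0 (enum_rank u)|.
pose S := \sum_u y u ^+ 2.
have S0 : 0 < S.
  have [i zi] : exists i, z ord0 i != 0 by exact/rV0Pn.
  rewrite /S (bigD1 (enum_val i)) //= ltr_pwDl //.
    by rewrite exprn_gt0 // /y enum_valK normr_gt0.
  by apply: sumr_ge0 => u _; rewrite sqr_ge0.
have s0 : 0 < Num.sqrt S by rewrite sqrtr_gt0.
exists (fun u => y u / Num.sqrt S); split.
- by move=> v; rewrite divr_ge0 ?normr_ge0 ?sqrtr_ge0.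
- rewrite (eq_bigr (fun v => y v ^+ 2 / S)) => [|v _].
    by rewrite -mulr_suml divff ?gt_eqF.
  by rewrite expr_div_n sqr_sqrtr // ltW.
move=> u; rewrite mulrA; under eq_bigr do rewrite mulrA.
rewrite -mulr_suml ler_wpM2r ?invr_ge0 ?sqrtr_ge0 //.
rewrite /y -(ger0_norm lam0) -normrM.
have -> : lam * z ord0 (enum_rank u) = \sum_v (adj u v)%:R * z ord0 (enum_rank v).
  have /matrixP/(_ ord0 (enum_rank u)) := zE; rewrite !mxE => <-.
  rewrite (reindex_onto enum_rank enum_val) /=; last by move=> i _; rewrite enum_valK.
  rewrite (eq_bigl predT) => [|v]; last by rewrite enum_rankK eqxx.
  by apply: eq_bigr => v _; rewrite mxE !enum_rankK adj_sym mulrC.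
apply: le_trans (ler_norm_sum _ _ _) _; apply: ler_sum => v _.
by rewrite normrM normr_nat.
Qed.

(** An eigenvalue above the bound would yield a spread-out weight of high density, hence order
    [m ^ (f/2)] copies of [F]. *)
Lemma spectral_radius_asymptotic_le (R : realType) (F : sgraph) n (alpha : R)
    (G : nat -> sgraph) : (0 < #|F|)%N -> colorable F n.+2 ->
  1 <= alpha -> 1 - n.+1%:R^-1 <= alpha / 2 ->
  (forall m, #|edges (G m)| = m) ->
  (fun m : nat => (copies F (G m))%:R : R^o)
    =o_\oo (fun m : nat => m%:R `^ (#|F|%:R / 2) : R^o) ->
  forall eps : R, 0 < eps -> \forall m \near \oo,
    spectral_radius R (G m) <= Num.sqrt ((alpha + eps) * m%:R).
Proof.
move=> F0 colF alpha1 alphan hm hN eps eps0.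
have [kappa k0 Hk] := weight_concentration alpha1 eps0.
have [c c0 Hc] := hom_supersaturation (divr_gt0 eps0 (ltr0Sn _ 3)) F0 colF.
set f := #|F| in F0 hN Hc.
pose D := (f ^ f)%:R * kappa ^+ f.
have D0 : 0 < D by rewrite mulr_gt0 ?exprn_gt0 // ltr0n expn_gt0 F0.
(* This constant bounds the weight of injective homomorphisms by [c / 4], and [t <= sqrt m] bounds
   the collisions by [c / 2]: together short of [c]. *)
have /eqoP/(_ (c / 4 / D)) := hN; rewrite !divr_gt0 // => /(_ isT) hN'.
pose t := 2 * (f ^ 2)%:R * kappa / c.
have t0 : 0 <= t by rewrite !mulr_ge0 ?invr_ge0 // ltW.
near=> m.
have m0 : (0 < m)%N by near: m; exists 1%N.
have tm : t ^+ 2 <= m%:R.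
  apply: le_trans (ltW (truncnS_gt (t ^+ 2))) _; rewrite ler_nat.
  by near: m; exact: nbhs_infty_ge.
have cm : `|(copies F (G m))%:R : R| <= c / 4 / D * `|m%:R `^ (f%:R / 2) : R|.
  by near: m.
set s := Num.sqrt (m%:R : R).
have s0 : 0 < s by rewrite sqrtr_gt0 ltr0n.
have ts : t <= s.
  by rewrite -[t](ger0_norm t0) -sqrtr_sqr; apply: ler_wsqrtr.
have {}cm : (copies F (G m))%:R <= c / 4 / D * s ^+ f.
  have pw : m%:R `^ (f%:R / 2) = s ^+ f.
    by rewrite mulrC powRrM powR12_sqrt // powR_mulrn ?sqrtr_ge0.
  by move: cm; rewrite pw normr_nat ger0_norm // exprn_ge0 // ltW.
have [E0|/set0P Ene] := eqVneq [set l : R | eigenvalue (adjmx R (G m)) l] set0.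
  by rewrite /spectral_radius E0 sup0 sqrtr_ge0.
apply: ge_sup => // lam /= Hlam; rewrite leNgt; apply/negP => lamlt.
have lam0 : 0 <= lam by apply: le_trans (ltW lamlt); exact: sqrtr_ge0.
have [x [x0 x1 xlam]] := eigenvalue_subeigenvector lam0 Hlam.
have em := sum_adj_edges (G m); rewrite hm in em.
have [w [w0 w1 wk we]] := Hk _ _ _ _ _ (@adj_sym (G m)) m0 em x0 x1 xlam (ltW lamlt).
have /(injective_hom_count w0 w1 wk) : c <=
    \sum_(h : {ffun F -> G m}) ffun_weight w h * (is_hom (@adj (G m)) h)%:R.
  apply: Hc => //; first exact: adj_sym.
  by apply: le_trans we; rewrite lerD2r.
have := injective_homs_copies F (G m).
rewrite -/f -(ler_nat R) natrM; set I := #|_|%:R => Icop.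
have ks0 : 0 < kappa / s by rewrite divr_gt0.
have h1 : I * (kappa / s) ^+ f <= c / 4.
  apply: le_trans (_ : c / 4 / D * s ^+ f * (f ^ f)%:R * (kappa / s) ^+ f <= _).
    apply: ler_wpM2r; first by rewrite exprn_ge0 // ltW.
    by apply: le_trans Icop _; apply: ler_wpM2r.
  rewrite expr_div_n le_eqVlt; apply/orP; left; apply/eqP.
  rewrite /D; field; rewrite !expf_neq0 ?gt_eqF //.
  by rewrite ltr0n expn_gt0 F0.
have h2 : (f ^ 2)%:R * (kappa / s) <= c / 2.
  by move: ts; rewrite /t ler_pdivrMr // => ts; rewrite mulrA ler_pdivrMr //; lra.
by lra.
Unshelve. all: by end_near.
Qed.

(** Take for [eps m] the actual excess of [rho m ^ 2 / (beta * m)] over [gam], truncated at 0;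
    replacing [rho] by its positive part makes squaring monotone. *)
Lemma sqrt_bound_eps (R : realType) (gam beta : R) (rho : nat -> R) :
  0 <= gam -> 0 < beta ->
  (forall eps : R, 0 < eps -> \forall m \near \oo,
     rho m <= Num.sqrt ((gam * beta + eps) * m%:R)) ->
  exists2 eps : nat -> R, eps m @[m --> \oo] --> (0 : R) &
    \forall m \near \oo, rho m <= Num.sqrt ((gam + eps m) * (beta * m%:R)).
Proof.
move=> gam0 beta0 Hrho.
pose r m := Num.max 0 (rho m).
exists (fun m => Num.max 0 (r m ^+ 2 / (beta * m%:R) - gam)).
  apply/cvgr0Pnorm_le => e e0; near=> m.
  have m0 : 0 < m%:R :> R by rewrite ltr0n; near: m; exists 1%N.
  have bm0 : 0 < beta * m%:R by rewrite mulr_gt0.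
  have Hm : rho m <= Num.sqrt ((gam * beta + e * beta) * m%:R).
    by near: m; apply: Hrho; rewrite mulr_gt0.
  rewrite ger0_norm ?le_max ?lexx // ge_max ltW //= lerBlDr ler_pdivrMr //.
  have rs : r m <= Num.sqrt ((gam * beta + e * beta) * m%:R).
    by rewrite /r ge_max sqrtr_ge0.
  have r0 : 0 <= r m by rewrite le_max lexx.
  apply: le_trans (_ : Num.sqrt ((gam * beta + e * beta) * m%:R) ^+ 2 <= _).
    by rewrite ler_pXn2r ?nnegrE ?sqrtr_ge0.
  rewrite sqr_sqrtr; first by lra.
  by rewrite mulr_ge0 ?(ltW m0) // -mulrDl mulr_ge0 ?(ltW beta0) // addr_ge0 // ltW.
near=> m.
have m0 : 0 < m%:R :> R by rewrite ltr0n; near: m; exists 1%N.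
have bm0 : 0 < beta * m%:R by rewrite mulr_gt0.
have r0 : 0 <= r m by rewrite le_max lexx.
apply: le_trans (_ : r m <= _); first by rewrite le_max lexx orbT.
rewrite -[leLHS](ger0_norm r0) -sqrtr_sqr; apply: ler_wsqrtr.
by rewrite -ler_pdivrMr // -lerBlDl le_max lexx orbT.
Unshelve. all: by end_near.
Qed.

Theorem theorem1p2 (R : realType) (F : sgraph) (f r : nat)
    (hf : #|F| = f)
    (hchi : chromatic_number F = r.+1)
    (hr : (2 <= r.+1)%N)
    (G : nat -> sgraph)
    (hm : forall m : nat, #|edges (G m)| = m)
    (hN : (fun m : nat => (copies F (G m))%:R : R^o)
            =o_\oo (fun m : nat => m%:R `^ (f%:R / 2) : R^o)) :
  ((2 <= r)%N ->
     exists2 eps : nat -> R, eps m @[m --> \oo] --> (0 : R) &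
       \forall m \near \oo,
         spectral_radius R (G m)
           <= Num.sqrt ((1 - 1 / r%:R + eps m) * (2 * m%:R))) /\
  (r = 1%N -> (2 <= min_indep_covering F)%N ->
     exists2 eps : nat -> R, eps m @[m --> \oo] --> (0 : R) &
       \forall m \near \oo,
         spectral_radius R (G m) <= Num.sqrt ((1 + eps m) * m%:R)).
Proof.
case: r hchi hr => // n hchi _; subst f.
have [colF F0] : colorable F n.+2 /\ (0 < #|F|)%N.
  move: hchi; rewrite /chromatic_number; case: ex_minnP => k colk kmin kn.
  split; first by rewrite -kn.
  (* An empty [F] would be 1-colourable. *)
  rewrite lt0n; apply/eqP => F0.
  suff /kmin : colorable F 1 by rewrite kn.
  apply/existsP; exists [ffun=> ord0]; apply/forallP => x.
  by have := fintype0 x F0.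
have Hle := spectral_radius_asymptotic_le F0 colF _ _ hm hN.
(* For [r >= 2], [alpha = 2 * (1 - 1/r)] is at least 1; for [r = 1] the density threshold is 0 and
   [alpha = 1] is the least value allowed. *)
split=> [n1|[n0] _].
  have in1 : (n.+1%:R : R)^-1 <= 2^-1 by rewrite lef_pV2 ?posrE // ler_nat.
  apply: (@sqrt_bound_eps _ _ 2 (fun m => spectral_radius R (G m))) => //.
    by rewrite mul1r; move: (_^-1) in1 => i in1; lra.
  by apply: Hle; rewrite mul1r; move: (n.+1%:R^-1) in1 => i in1; lra.
have [eps eps0 H] : exists2 eps : nat -> R, eps m @[m --> \oo] --> (0 : R) &
    \forall m \near \oo,
      spectral_radius R (G m) <= Num.sqrt ((1 + eps m) * (1 * m%:R)).
  apply: (@sqrt_bound_eps _ 1 1 (fun m => spectral_radius R (G m))) => //.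
  rewrite mulr1; apply: Hle => //; rewrite n0 invr1; lra.
by exists eps => //; near=> m; rewrite -[X in _ * X]mul1r; near: m.
Unshelve. all: by end_near.
Qed.
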